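(* Let $\mathcal{A}=\{v_1,\dots,v_n\}\subset\mathbb{R}^m$ be a finite set, $C:=\operatorname{conv}(\mathcal{A})$, $D:=\max\{\|x-y\| : x,y\in C\}$, $p\in\mathbb{R}^m$, and $\Psi(y):=\frac12\|y-p\|^2$. Let $p_k\in C$ with $p_k\neq p$, and let $v_i\in\mathcal{A}$ be a pivot at $p_k$, i.e. $\|v_i-p\|\le\|v_i-p_k\|$. Let $j\in\arg\min_{1\le l\le n} v_l^T(p_k-p)$ and set $$\bar\gamma_k:=-\frac{(p_k-p)^T(v_j-p_k)}{\|v_j-p_k\|^2},\qquad \hat\delta_k:=\frac{2}{D^2}\|v_j-p_k\|^2 .$$ Then $v_i$ is an inexact solution of the Frank--Wolfe subproblem for $\Psi$ over $C$ at $p_k$ with inexactness parameter $\hat\delta_k$, in the sense that $$(v_i-p_k)^T\nabla\Psi(p_k)\le \min_{y\in C}(y-p_k)^T\nabla\Psi(p_k)+\frac12\,\hat\delta_k\,\bar\gamma_k\,C_\Psi ,$$ where $C_\Psi$ is the curvature constant of $\Psi$ with respect to $C$ (equal to $D^2$).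
   Context: $\|\cdot\|$ is the Euclidean norm. The curvature constant of a differentiable convex function $f$ with respect to a compact convex set $C$ is $$C_f:=\sup\Big\{\tfrac{2}{\gamma^2}\big(f(y)-f(x)-(y-x)^T\nabla f(x)\big) : x,s\in C,\ \gamma\in(0,1],\ y=x+\gamma(s-x)\Big\};$$ for $\Psi(y)=\frac12\|y-p\|^2$ one has $\nabla\Psi(y)=y-p$ and $C_\Psi=D^2$. *)

(* Defs.v *)
From HB Require Import structures.
From mathcomp Require Import all_boot all_order all_algebra.
From mathcomp Require Import all_classical all_reals all_analysis.

Set Implicit Arguments.
Unset Strict Implicit.
Unset Printing Implicit Defensive.

Import Order.TTheory GRing.Theory Num.Theory.
Import numFieldNormedType.Exports.

Local Open Scope classical_set_scope.
Local Open Scope ring_scope.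

(* The library norm `|x| on 'cV[R]_m is the sup norm, so the Euclidean norm is
   defined separately; the library norm is only used, through 'D_v, as a norm
   defining the usual topology of R^m. *)
Definition dot (R : realType) (m : nat) (x y : 'cV[R]_m) : R := (x^T *m y) 0 0.

Definition enorm (R : realType) (m : nat) (x : 'cV[R]_m) : R :=
  Num.sqrt (dot x x).

Definition conv_hull (R : realType) (m n : nat) (v : 'I_n -> 'cV[R]_m) :
    set 'cV[R]_m :=
  [set x | exists a : 'I_n -> R,
     [/\ forall l, 0 <= a l, \sum_l a l = 1 & x = \sum_l a l *: v l]].

Definition is_max (R : realType) (A : set R) (M : R) : Prop :=
  A M /\ ubound A M.

Definition is_min (R : realType) (A : set R) (mu : R) : Prop :=
  A mu /\ lbound A mu.

Definition grad (R : realType) (m : nat) (f : 'cV[R]_m -> R) (x : 'cV[R]_m) :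
    'cV[R]_m :=
  \col_i 'D_(delta_mx i 0) f x.

(* Extended-real valued: for a general f the supremum may be +oo. *)
Definition curvature (R : realType) (m : nat) (f : 'cV[R]_m -> R)
    (C : set 'cV[R]_m) : \bar R :=
  ereal_sup [set t : \bar R | exists x s y : 'cV[R]_m, exists gamma : R,
    [/\ C x, C s, 0 < gamma <= 1, y = x + gamma *: (s - x) &
        t = (2 / gamma ^+ 2 * (f y - f x - dot (y - x) (grad f x)))%:E]].

Definition Psi (R : realType) (m : nat) (p y : 'cV[R]_m) : R :=
  2^-1 * enorm (y - p) ^+ 2.

(* Main.v *)
Require Import Defs.
From HB Require Import structures.
From mathcomp Require Import all_boot all_order all_algebra.
From mathcomp Require Import all_classical all_reals all_analysis.
From mathcomp Require Import ring lra.

Import Order.TTheory GRing.Theory Num.Theory.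
Import numFieldNormedType.Exports.

Local Open Scope classical_set_scope.
Local Open Scope ring_scope.

(** Write [w = pk - p], which is the gradient of [Psi p] at [pk]. A linear form
    on the hull is minimised at a vertex, so the minimum is
    [mu = (v j - pk) . w], and the weight of the error term is chosen so that
    the right-hand side is [mu - mu = 0]. Expanding
    [|v i - p|^2 = |v i - pk|^2 + 2 (v i - pk) . w + |w|^2], the pivot condition
    says that [2 (v i - pk) . w <= - |w|^2 <= 0]. The curvature constant is
    [D^2] because [Psi p] is quadratic: the expression under the supremum is
    exactly [|s - x|^2]. *)

Section EuclideanSpace.
Variables (R : realType) (m : nat).
Implicit Types (x y z p : 'cV[R]_m) (c : R).

Lemma dotC x y : dot x y = dot y x.
Proof. by rewrite /dot !mxE; apply: eq_bigr => k _; rewrite !mxE mulrC. Qed.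

Lemma dotDl x y z : dot (x + y) z = dot x z + dot y z.
Proof. by rewrite /dot linearD mulmxDl mxE. Qed.

Lemma dotZl c x z : dot (c *: x) z = c * dot x z.
Proof. by rewrite /dot linearZ -scalemxAl mxE. Qed.

Lemma dotDr x y z : dot z (x + y) = dot z x + dot z y.
Proof. by rewrite dotC dotDl !(dotC z). Qed.

Lemma dotZr c x z : dot z (c *: x) = c * dot z x.
Proof. by rewrite dotC dotZl (dotC z). Qed.

Lemma dot0l x : dot 0 x = 0.
Proof. by rewrite -(scale0r x) dotZl mul0r. Qed.

Lemma dotBl x y z : dot (x - y) z = dot x z - dot y z.
Proof. by rewrite dotDl -scaleN1r dotZl mulN1r. Qed.

Lemma dot_suml (I : finType) (F : I -> 'cV[R]_m) z :
  dot (\sum_l F l) z = \sum_l dot (F l) z.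
Proof.
by apply: (big_morph (fun x => dot x z)) => [x y|]; rewrite ?dotDl ?dot0l.
Qed.

Lemma dot_delta k x : dot (delta_mx k 0) x = x k 0.
Proof.
rewrite /dot !mxE (bigD1 k) //= !mxE !eqxx mul1r big1 ?addr0 // => l lk.
by rewrite !mxE (negbTE lk) mul0r.
Qed.

Lemma dot_ge0 x : 0 <= dot x x.
Proof. by rewrite /dot !mxE sumr_ge0 // => k _; rewrite !mxE -expr2 sqr_ge0. Qed.

(** A vanishing sum of squares forces every coordinate to vanish. *)
Lemma dot_eq0 x : dot x x = 0 -> x = 0.
Proof.
rewrite /dot mxE => /eqP; rewrite psumr_eq0 => [/allP xx0|k _]; last first.
  by rewrite !mxE -expr2 sqr_ge0.
apply/matrixP => k l; rewrite (ord1 l) mxE.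
by have := xx0 k (mem_index_enum _); rewrite !mxE -expr2 sqrf_eq0 => /eqP.
Qed.

Lemma enorm_ge0 x : 0 <= enorm x.
Proof. exact: sqrtr_ge0. Qed.

Lemma enorm_sqr x : enorm x ^+ 2 = dot x x.
Proof. by rewrite sqr_sqrtr // dot_ge0. Qed.

Lemma enormD_sqr x y :
  enorm (x + y) ^+ 2 = enorm x ^+ 2 + 2 * dot x y + enorm y ^+ 2.
Proof. rewrite !enorm_sqr !dotDl !dotDr (dotC y x); ring. Qed.

Lemma enormZ_sqr c x : enorm (c *: x) ^+ 2 = c ^+ 2 * enorm x ^+ 2.
Proof. by rewrite !enorm_sqr dotZl dotZr mulrA. Qed.

(** Second-order Taylor expansion, exact because [Psi p] is quadratic: the linear term yields the
    gradient, the remainder the curvature. *)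
Lemma Psi_shift p x y :
  Psi p (x + y) = Psi p x + dot y (x - p) + 2^-1 * enorm y ^+ 2.
Proof. by rewrite /Psi (addrAC x) (enormD_sqr (x - p)) (dotC y); field. Qed.

Lemma derive_Psi p x d : 'D_d (Psi p) x = dot d (x - p).
Proof.
rewrite /derive; apply: cvg_lim => //.
(* For [h != 0] the difference quotient is affine in [h], with constant term [dot d (x - p)]. *)
apply: (@cvg_trans _
    ((fun h : R => dot d (x - p) + h * (2^-1 * enorm d ^+ 2)) @ 0^')).
  apply: near_eq_cvg; near=> h.
  have h0 : h != 0 by near: h; exact: nbhs_dnbhs_neq.
  rewrite /= (addrC (h *: d)) Psi_shift dotZl enormZ_sqr /GRing.scale /=.
  by field.
(* Write the limit as the value of that affine function at [h = 0], so that the limit rules for sums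
   and products apply. *)
have {2}-> : dot d (x - p) = dot d (x - p) + 0 * (2^-1 * enorm d ^+ 2).
  by rewrite mul0r addr0.
apply: cvgD; first exact: cvg_cst.
by apply: cvgM; [exact: nbhs_dnbhs|exact: cvg_cst].
Unshelve. all: by end_near. Qed.

Lemma grad_Psi p x : grad (Psi p) x = x - p.
Proof.
by apply/matrixP => k l; rewrite (ord1 l) mxE derive_Psi dot_delta.
Qed.

Lemma curvature_Psi (C : set 'cV[R]_m) (D : R) p :
  is_max [set enorm (x - y) | x in C & y in C] D ->
  curvature (Psi p) C = (D ^+ 2)%:E.
Proof.
move=> [[x Cx [y Cy DE]] Dub].
have quad u s (g : R) : g != 0 -> 2 / g ^+ 2 * (Psi p (u + g *: (s - u)) -
    Psi p u - dot (u + g *: (s - u) - u) (grad (Psi p) u)) = enorm (s - u) ^+ 2.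
  move=> g0; rewrite grad_Psi (addrAC u) subrr add0r Psi_shift enormZ_sqr.
  by field.
apply/eqP; rewrite eq_le; apply/andP; split.
  apply: ge_ereal_sup => _ [u [s [_ [g [Cu Cs /andP[g0 _] -> ->]]]]].
  rewrite quad ?gt_eqF // lee_fin ler_pXn2r ?nnegrE ?enorm_ge0 //.
    by apply: Dub; exists s => //; exists u.
  by rewrite -DE enorm_ge0.
(* The supremum is attained by a full step, [gamma = 1], between two points realising the
   diameter. *)
apply: ereal_sup_ubound; exists y, x, (y + 1 *: (x - y)), 1.
by split; rewrite ?ltr01 ?lexx // quad ?oner_eq0 // DE.
Qed.

End EuclideanSpace.

Section ConvexHull.
Variables (R : realType) (m n : nat) (v : 'I_n -> 'cV[R]_m).

Lemma conv_hull_vertex j : conv_hull v (v j).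
Proof.
exists (fun l => (l == j)%:R); split => [l||]; first exact: ler0n.
  by rewrite (bigD1 j) //= eqxx big1 ?addr0 // => l /negbTE ->.
by rewrite (bigD1 j) //= eqxx scale1r big1 ?addr0 // => l /negbTE ->; rewrite scale0r.
Qed.

(** Since the weights sum to 1, [c] is itself their weighted sum of copies of [c], and the
    comparison is termwise. *)
Lemma conv_hull_dot_ge (w : 'cV[R]_m) (c : R) x :
  (forall l, c <= dot (v l) w) -> conv_hull v x -> c <= dot x w.
Proof.
move=> cv [a [a0 a1 ->]]; rewrite dot_suml -[c]mul1r -a1 mulr_suml.
by apply: ler_sum => l _; rewrite dotZl ler_wpM2l.
Qed.

End ConvexHull.

Lemma pivot_dot_le0 (R : realType) (m : nat) (p q u : 'cV[R]_m) :
  enorm (u - p) <= enorm (u - q) -> dot (u - q) (q - p) <= 0.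
Proof.
rewrite -(ler_pXn2r (n := 2)) ?nnegrE ?enorm_ge0 //.
(* Split [u - p] as [(u - q) + (q - p)]. *)
rewrite -(subrKA q u (- p)) enormD_sqr => h.
have := sqr_ge0 (enorm (q - p)); lra.
Qed.

Theorem mainTheorem1 (R : realType) (m n : nat) (v : 'I_n -> 'cV[R]_m)
    (D : R)
    (hD : is_max [set enorm (x - y) | x in conv_hull v & y in conv_hull v] D)
    (p pk : 'cV[R]_m) (hpk : conv_hull v pk) (hne : pk <> p)
    (i : 'I_n) (hpivot : enorm (v i - p) <= enorm (v i - pk))
    (j : 'I_n) (hj : forall l : 'I_n, dot (v j) (pk - p) <= dot (v l) (pk - p)) :
  let gammabar := - (dot (pk - p) (v j - pk) / enorm (v j - pk) ^+ 2) in
  let deltahat := 2 / D ^+ 2 * enorm (v j - pk) ^+ 2 in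
  (exists mu : R,
     is_min [set dot (y - pk) (grad (Psi p) pk) | y in conv_hull v] mu /\
     ((dot (v i - pk) (grad (Psi p) pk))%:E <=
        mu%:E + (2^-1 * deltahat * gammabar)%:E * curvature (Psi p) (conv_hull v))%E)
  /\ curvature (Psi p) (conv_hull v) = (D ^+ 2)%:E.
Proof.
move=> gammabar deltahat; rewrite (curvature_Psi _ _ _ _ _ hD) grad_Psi.
split=> //; exists (dot (v j - pk) (pk - p)); split.
  split; first by exists (v j) => //; exact: conv_hull_vertex.
  move=> _ [y Cy <-]; rewrite !dotBl lerD2r.
  exact: conv_hull_dot_ge Cy.
rewrite -EFinM -EFinD lee_fin /deltahat /gammabar (dotC _ _ (pk - p)).
(* Both [D ^+ 2] and [enorm (v j - pk) ^+ 2] cancel in the error term, leaving minus the minimum. *)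
suff -> : dot (v j - pk) (pk - p) + 2^-1 * (2 / D ^+ 2 * enorm (v j - pk) ^+ 2) *
    - (dot (v j - pk) (pk - p) / enorm (v j - pk) ^+ 2) * D ^+ 2 = 0.
  exact: pivot_dot_le0.
(* If [v j = pk], the division by zero in [gammabar] is harmless: [mu = 0]. *)
have [vj0|vj0] := eqVneq (enorm (v j - pk) ^+ 2) 0.
  move: (vj0); rewrite enorm_sqr => /dot_eq0 ->.
  by rewrite dot0l !(mul0r, oppr0, mulr0, addr0).
(* [D] bounds the distance between the hull points [v j] and [pk], which is nonzero here. *)
have D0 : D != 0.
  apply: contra_neq vj0 => D0; apply/eqP.
  rewrite sqrf_eq0 eq_le enorm_ge0 andbT -D0.
  by apply: (proj2 hD); exists (v j); [exact: conv_hull_vertex|exists pk].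
by field; rewrite D0 andbT -sqrf_eq0.
Qed.
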